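(* Let $t>0$ be a real number and let $M=(X,d)$ be a metric space. Then $M$ is compact if and only if the gravitational metric space $M_t=(X,d_t)$ is compact.
   Context: For a metric space $M=(X,d)$ and a real number $t>0$, the gravitational metric space $M_t=(X,d_t)$ is the set $X$ equipped with the metric $d_t(x,y)=\min\{2t,d(x,y)\}$ for all $x,y\in X$. *)

(* Defs.v *)
From HB Require Import structures.
From mathcomp Require Import all_boot all_order all_algebra.
From mathcomp Require Import all_classical all_reals all_analysis.

Set Implicit Arguments.
Unset Strict Implicit.
Unset Printing Implicit Defensive.

Import Order.TTheory GRing.Theory Num.Theory.
Local Open Scope ring_scope.

(* The carrier of [M] under a new name, so that it can bear its own metric (and
   the topology induced by that metric) instead of inheriting those of [M]. The
   proof of [0 < t] is a parameter because the metric axioms depend on it. *)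
Definition gravitational (R : realType) (t : R) (t0 : 0 < t)
  (M : metricType R) : Type := M.

Definition gravitational_dist (R : realType) (t : R) (M : metricType R)
  (x y : M) : R := Num.min (2 * t) (mdist x y).

Section gravitational_metric.
Context (R : realType) (t : R) (t0 : 0 < t) (M : metricType R).

Let dist : gravitational t0 M -> gravitational t0 M -> R :=
  @gravitational_dist R t M.

Let distxx x : dist x x = 0.
Proof.
by rewrite /dist /gravitational_dist mdistxx min_r// mulr_ge0// ltW.
Qed.

Let dist_positivity x y : dist x y = 0 -> x = y.
Proof.
rewrite /dist /gravitational_dist minEle; case: ifPn => _; last first.
  exact: mdist_positivity.
by move/eqP; rewrite mulf_eq0 pnatr_eq0/= gt_eqF.
Qed.

Let dist_sym x y : dist x y = dist y x.
Proof. by rewrite /dist /gravitational_dist metric_sym. Qed.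

Let dist_triangle y x z : dist x z <= dist x y + dist y z.
Proof.
rewrite /dist /gravitational_dist.
have tt0 : 0 <= 2 * t by rewrite mulr_ge0// ltW.
have xy0 := @mdist_ge0 R M x y; have yz0 := @mdist_ge0 R M y z.
have xyz := @metric_triangle R M x y z.
rewrite ge_min; case: (leP (2 * t) (mdist x y)) => _.
  by rewrite lerDl le_min tt0 yz0.
case: (leP (2 * t) (mdist y z)) => _; first by rewrite lerDr xy0.
by rewrite xyz orbT.
Qed.

HB.instance Definition _ := Choice.copy (gravitational t0 M) M.

HB.instance Definition _ := @isMetric.Build R (gravitational t0 M)
  dist distxx dist_positivity dist_sym dist_triangle.

End gravitational_metric.

Lemma gravitational_mdistE (R : realType) (t : R) (t0 : 0 < t)
    (M : metricType R) (x y : gravitational t0 M) :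
  mdist x y = Num.min (2 * t) (mdist (x : M) (y : M)).
Proof. by []. Qed.

(* Main.v *)
Require Import Defs.
From mathcomp Require Import all_boot all_order all_algebra.
From mathcomp Require Import all_classical all_reals all_analysis.

Import Order.TTheory GRing.Theory Num.Theory.
Local Open Scope classical_set_scope.
Local Open Scope ring_scope.

(** Truncating a metric at 2t changes no distance below 2t, and a topology
    depends only on small distances. The identity between the two spaces
    therefore satisfies [continuous_of_small_isometry] with scale 2t in both
    directions, and as it is onto, [compact_setT_surjection] carries compactness
    from either space to the other. *)

(** Below the scale [delta] the map is an isometry, so the image of a ball of
    radius [min e delta] lies in the ball of radius [e]. *)
Lemma continuous_of_small_isometry (R : realType) (M N : metricType R)
    (delta : R) (f : M -> N) :
  0 < delta ->
  (forall x y, mdist x y < delta -> mdist (f x) (f y) = mdist x y) ->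
  continuous f.
Proof.
move=> delta0 iso x; apply/cvg_ballP => e e0.
apply/nbhs_ballP; exists (Num.min e delta); first by rewrite /= lt_min e0.
move=> y /=; rewrite !ballEmdist/= lt_min => /andP[xye xyd].
by rewrite iso.
Qed.

Lemma compact_setT_surjection (S T : topologicalType) (f : S -> T) :
  continuous f -> range f = [set: T] -> compact [set: S] -> compact [set: T].
Proof.
move=> cf <-; apply: continuous_compact.
exact: continuous_subspaceT.
Qed.

Theorem theorem9 (R : realType) (t : R) (t0 : 0 < t) (M : metricType R) :
  compact [set: M] <-> compact [set: gravitational t0 M].
Proof.
have tt0 : 0 < 2 * t by rewrite mulr_gt0.
split.
- apply: (@compact_setT_surjection M (gravitational t0 M) idfun).
    apply: (continuous_of_small_isometry _ _ _ _ _ tt0) => x y xy.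
    by rewrite gravitational_mdistE min_r// ltW.
  exact: image_id.
- apply: (@compact_setT_surjection (gravitational t0 M) M idfun).
    (* A truncated distance below 2t has not been truncated. *)
    apply: (continuous_of_small_isometry _ _ _ _ _ tt0) => x y.
    by rewrite gravitational_mdistE gt_min ltxx/= => xy; rewrite min_r// ltW.
  exact: image_id.
Qed.
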